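(* Let $m\ge 3$ and $\epsilon\in\{+1,-1\}$. Let $Q$ be a nondegenerate quadratic form on $V=\mathbb{F}_3^{2m}$ of type $\epsilon$ (hyperbolic if $\epsilon=+1$, elliptic if $\epsilon=-1$), with polar form $B(x,y)=Q(x+y)-Q(x)-Q(y)$. Let $\mathrm{NO}^\epsilon_{2m}(3)$ be the graph whose vertices are the $1$-dimensional subspaces $\langle x\rangle$ with $Q(x)=1$, two distinct vertices $\langle x\rangle,\langle y\rangle$ being adjacent if $B(x,y)=0$. Then $\mathrm{NO}^\epsilon_{2m}(3)$ is separating.
   Context: A graph $\Gamma$ is separating if $\omega(\Gamma)\alpha(\Gamma)<|V(\Gamma)|$, where $\omega$ and $\alpha$ are the maximum clique and coclique sizes. (This property is unchanged on passing to the complementary graph.) *)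

(* Defs.v *)
From HB Require Import structures.
From mathcomp Require Import all_boot all_order all_algebra.

Set Implicit Arguments.
Unset Strict Implicit.
Unset Printing Implicit Defensive.

Import GRing.Theory VectorInternalTheory.
Local Open Scope ring_scope.

Record sgraph := SGraph {
  vertex :> finType;
  adj : rel vertex;
  adj_sym : symmetric adj;
  adj_irrefl : irreflexive adj }.

Definition is_clique (G : sgraph) (A : {set G}) : bool :=
  [forall x in A, forall y in A, (x != y) ==> adj x y].

Definition is_coclique (G : sgraph) (A : {set G}) : bool :=
  [forall x in A, forall y in A, ~~ adj x y].

Definition clique_number (G : sgraph) : nat :=
  (\max_(A : {set G} | is_clique A) #|A|)%N.

Definition coclique_number (G : sgraph) : nat :=
  (\max_(A : {set G} | is_coclique A) #|A|)%N.

Definition separating (G : sgraph) : Prop :=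
  (clique_number G * coclique_number G < #|G|)%N.

(* The library gives {vspace V} only a choiceType structure; over a finite
   field it is a finite type. *)
HB.instance Definition _ (F : finFieldType) (V : vectType F) :=
  [Countable of {vspace V} by <:].
HB.instance Definition _ (F : finFieldType) (V : vectType F) :=
  [Finite of {vspace V} by <:].

Section QuadraticForm.
Variables (F : finFieldType) (n : nat) (Q : 'rV[F]_n -> F).

Definition polar (x y : 'rV[F]_n) : F := Q (x + y) - Q x - Q y.

Definition quadratic_form : Prop :=
  (forall (a : F) (x : 'rV[F]_n), Q (a *: x) = a ^+ 2 * Q x)
  /\ bilinear_for *%R *%R polar.

(* Only meant for odd characteristic; in characteristic 2 this is the stronger
   of the two usual notions. *)
Definition nondegenerate_form : Prop :=
  forall x : 'rV[F]_n, (forall y : 'rV[F]_n, polar x y = 0) -> x = 0.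

Definition totally_singular (U : {vspace 'rV[F]_n}) : bool :=
  [forall x : 'rV[F]_n, (x \in U) ==> (Q x == 0)].

Definition witt_index : nat :=
  (\max_(U : {vspace 'rV[F]_n} | totally_singular U) \dim U)%N.

(* For a nondegenerate form on a space of dimension n = 2m, the Witt index is
   m in the hyperbolic case and m - 1 in the elliptic case. *)
Definition hyperbolic : Prop := n = (2 * witt_index)%N.
Definition elliptic : Prop := n = (2 * witt_index.+1)%N.

(* Only meant for eps = 1 or eps = -1. *)
Definition has_type (eps : int) : Prop :=
  if eps == 1 then hyperbolic else elliptic.

Definition NO_vertex :=
  {U : {vspace 'rV[F]_n} | [exists x : 'rV[F]_n, (Q x == 1) && (U == <[x]>%VS)]}.

Definition NO_adj (U W : NO_vertex) : bool :=
  (U != W) &&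
  [exists x : 'rV[F]_n, exists y : 'rV[F]_n,
     [&& val U == <[x]>%VS, val W == <[y]>%VS & polar x y == 0]].

Fact NO_adj_sym : symmetric NO_adj.
Proof.
suff imp U W : NO_adj U W -> NO_adj W U by move=> U W; apply/idP/idP; apply: imp.
case/andP=> neqUW /existsP[x /existsP[y /and3P[Ux Wy xy0]]].
rewrite /NO_adj eq_sym neqUW; apply/existsP; exists y; apply/existsP; exists x.
by rewrite Ux Wy /= /polar [y + x]addrC addrAC.
Qed.

Fact NO_adj_irrefl : irreflexive NO_adj.
Proof. by move=> U; rewrite /NO_adj eqxx. Qed.

Definition NO_graph : sgraph := SGraph NO_adj_sym NO_adj_irrefl.
End QuadraticForm.

(* Main.v *)
(* A clique consists of pairwise orthogonal vectors of norm 1, which are linearly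
   independent, so omega <= 2m.

   Let C be a set of vectors of norm 1 representing a coclique. For c <> c' in C
   one of c' - c, c' + c is a singular vector t orthogonal to c, and
   {c,c'}^perp = {c,t}^perp; hence the number of vectors of a given norm
   orthogonal to both does not depend on (c,c'). So the first two moments of
   v |-> #{c in C | c _|_ v} over the vectors v of a given norm are known
   functions of |C|, and the Cauchy-Schwarz inequality bounds |C|. In the
   hyperbolic case the vectors v of norm 1 give alpha <= (3^m - 1)/2; in the
   elliptic case the singular v give alpha <= 3^m - 2. Both suffice, except for
   the elliptic case with m = 3, where |G| = 126 is the product of omega = 6 with
   the Hoffman bound 21; there the integrality of the degrees excludes |C| = 21.

   The numbers of vectors of each norm are obtained by summing over the cosets of
   a maximal totally singular subspace. *)

Require Import Defs.
From mathcomp Require Import all_boot all_order all_algebra all_field zify ring.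

Set Implicit Arguments.
Unset Strict Implicit.
Unset Printing Implicit Defensive.

Import GRing.Theory.
Local Open Scope ring_scope.

(** * Arithmetic in ['F_3], counting by translation, Cauchy-Schwarz *)

Local Notation "N[ v | P ]" := (\sum_v (nat_of_bool P%R))%N
  (at level 0, v name, format "N[ v  |  P ]").

(* The sums are abstracted because lia, given them as atoms, compares them up to
   conversion and does not return. *)
Local Ltac sums_lia :=
  repeat (let k := fresh "k" in set k := (\sum_(_ <- _ | _) _)%N; clearbody k);
  clear; lia.

Lemma F3P (x : 'F_3) : [\/ x = 0, x = 1 | x = -1].
Proof.
by case: x => [[|[|[|k]]] i] //; [apply: Or31 | apply: Or32 | apply: Or33];
  apply/val_inj.
Qed.

Lemma F3_two : 1 + 1 = -1 :> 'F_3.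
Proof. exact/val_inj. Qed.

Lemma F3_indicators (x a : 'F_3) :
  ((x == a)%R + (x == a + 1)%R + (x == a - 1)%R = 1)%N.
Proof. by case: (F3P x) => ->; case: (F3P a) => ->. Qed.

Lemma F3_sqr (x : 'F_3) : x != 0 -> x * x = 1.
Proof. by case: (F3P x) => -> // _; apply/val_inj. Qed.

(** Translation by [w] preserves [P] and cycles [f] through ['F_3], so the three level sets of [f]
    in [P] are equally large. *)
Lemma shift_count (V : finZmodType) (P : pred V) (f : V -> 'F_3) (w : V) a :
    (forall v, P (v + w) = P v) -> (forall v, P v -> f (v + w) = f v + 1) ->
  (N[v | P v] = 3 * N[v | P v && (f v == a)])%N.
Proof.
move=> Pw fw.
have step b : (N[v | P v && (f v == b + 1)] = N[v | P v && (f v == b)])%N.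
  rewrite (reindex_inj (addIr w)); apply: eq_bigr => v _.
  by rewrite Pw; case Pv: (P v) => //=; rewrite fw // (inj_eq (addIr 1)).
transitivity (N[v | P v && (f v == a)] + N[v | P v && (f v == a + 1)]
  + N[v | P v && (f v == a - 1)])%N.
  rewrite -!big_split; apply: eq_bigr => v _ /=.
  by case: (P v); rewrite //= F3_indicators.
by rewrite step -(step (a - 1)) subrK; sums_lia.
Qed.

(** Both sides expand to double sums; doubled and symmetrized, they compare termwise by
    [2 * (f v * f w) <= f v ^ 2 + f w ^ 2]. *)
Lemma weighted_Cauchy (T : finType) (P : pred T) (f : T -> nat) :
  ((\sum_v P v * f v) ^ 2 <= (\sum_v P v) * (\sum_v P v * f v ^ 2))%N.
Proof.
have sq : ((\sum_v P v * f v) ^ 2 = \sum_v \sum_w P v * P w * (f v * f w))%N.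
  rewrite expnS expn1 big_distrl; apply: eq_bigr => v _; rewrite big_distrr.
  by apply: eq_bigr => w _ /=; rewrite mulnACA.
have pr : ((\sum_v P v) * (\sum_v P v * f v ^ 2) =
    \sum_v \sum_w P v * P w * f w ^ 2)%N.
  rewrite big_distrl; apply: eq_bigr => v _; rewrite big_distrr.
  by apply: eq_bigr => w _ /=; rewrite mulnA.
rewrite -(leq_pmul2l (isT : 0 < 2)%N) [leqRHS]mul2n -addnn {1}pr exchange_big pr sq.
rewrite big_distrr -big_split; apply: leq_sum => v _ /=.
rewrite big_distrr -big_split; apply: leq_sum => w _ /=.
by rewrite [(P w * P v)%N]mulnC -mulnDr mulnCA leq_mul2l nat_Cauchy orbT.
Qed.

(** * Identities for a quadratic form over ['F_3] and its polar form *)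

Section Forms.
Variables (n : nat) (Q : 'rV['F_3]_n -> 'F_3).
Hypotheses (HQ : quadratic_form Q) (ND : nondegenerate_form Q).
Local Notation V := 'rV['F_3]_n.
Local Notation B := (polar Q).
Implicit Types (x y v w c t : V) (a : 'F_3) (U : {vspace V}).

Lemma polarC x y : B x y = B y x.
Proof. by rewrite /polar [y + x]addrC addrAC. Qed.

Lemma polarZDl a x y v : B (a *: x + y) v = a * B x v + B y v.
Proof. by case: HQ => _ [+ _] => /(_ v a x y). Qed.

Lemma polarDl x y v : B (x + y) v = B x v + B y v.
Proof. by rewrite -[x]scale1r polarZDl mul1r scale1r. Qed.

Lemma polar0l v : B 0 v = 0.
Proof. by apply: (addrI (B 0 v)); rewrite -polarDl !addr0. Qed.

Lemma polarZl a x v : B (a *: x) v = a * B x v.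
Proof. by rewrite -[a *: x]addr0 polarZDl polar0l addr0. Qed.

Lemma polarNl x v : B (- x) v = - B x v.
Proof. by rewrite -scaleN1r polarZl mulN1r. Qed.

Lemma polarDr x y v : B v (x + y) = B v x + B v y.
Proof. by rewrite polarC polarDl ![B _ v]polarC. Qed.

Lemma polarZr a x v : B v (a *: x) = a * B v x.
Proof. by rewrite polarC polarZl polarC. Qed.

Lemma polarNr x v : B v (- x) = - B v x.
Proof. by rewrite polarC polarNl polarC. Qed.

Lemma polar0r v : B v 0 = 0.
Proof. by rewrite polarC polar0l. Qed.

Lemma polar_suml (I : finType) (F : I -> V) v :
  B (\sum_i F i) v = \sum_i B (F i) v.
Proof.
by apply: (big_morph (B^~ v)) => [x y|]; [apply: polarDl | apply: polar0l].
Qed.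

Lemma quadD x y : Q (x + y) = Q x + Q y + B x y.
Proof. by rewrite /polar; ring. Qed.

Lemma quadZ a x : Q (a *: x) = a ^+ 2 * Q x.
Proof. by case: HQ. Qed.

Lemma quad0 : Q 0 = 0.
Proof. by rewrite -(scale0r 0) quadZ expr0n mul0r. Qed.

Lemma quadN x : Q (- x) = Q x.
Proof. by rewrite -scaleN1r quadZ sqrrN expr1n mul1r. Qed.

Lemma polarxx x : B x x = - Q x.
Proof.
rewrite /polar -mulr2n -scaler_nat quadZ.
have -> : 2 ^+ 2 = 1 :> 'F_3 by apply/val_inj.
by rewrite mul1r subrr sub0r.
Qed.

(** * Vectors of given norm orthogonal to one or two vectors of norm 1 *)

Lemma exists_polar1 x : x != 0 -> exists w, B w x = 1.
Proof.
move=> x0; have [/forallP h|] := boolP [forall y, B x y == 0].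
  by case/eqP: x0; apply: ND => y; apply/eqP.
case/forallPn => y Bxy; exists (B x y *: y).
by rewrite polarZl [B y x]polarC F3_sqr.
Qed.

(* Translation by e and by -e reduces the vectors not orthogonal to e to the
   orthogonal ones. *)
Lemma count_nonisotropic (P : pred V) e a : Q e != 0 ->
    (forall v, P (v + e) = P v) ->
  (N[v | P v && (Q v == a)] = N[v | [&& P v, B v e == 0 & Q v == a]]
     + 2 * N[v | [&& P v, B v e == 0 & Q v == a - Q e]])%N.
Proof.
move=> Qe Pe; set S0 := (N[v | [&& P v, B v e == 0 & Q v == a]] )%N.
set S1 := (X in (_ + 2 * X)%N).
have PN v : P (v - e) = P v by rewrite -(Pe (v - e)) subrK.
have Sp : (N[v | [&& P v, B v e == - Q e & Q v == a]] = S1)%N.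
  rewrite (reindex_inj (addIr e)); apply: eq_bigr => v _.
  rewrite Pe polarDl polarxx quadD -subr_eq0 opprK addrNK.
  by case: eqP => //= ->; rewrite addr0 -(inj_eq (addIr (Q e)) (Q v)) subrK.
have Sm : (N[v | [&& P v, B v e == Q e & Q v == a]] = S1)%N.
  rewrite (reindex_inj (addIr (- e))); apply: eq_bigr => v _.
  rewrite PN polarDl polarNl polarxx quadD opprK -subr_eq0 addrK.
  case: eqP => //= Bve; rewrite polarNr quadN Bve oppr0 addr0.
  by rewrite -(inj_eq (addIr (Q e)) (Q v)) subrK.
rewrite mul2n -addnn -{1}Sp -Sm /S0 -!big_split; apply: eq_bigr => v _ /=.
case: (P v) => //=; case: (Q v == a); rewrite ?andbF //=.
by case: (F3P (Q e)) Qe => -> // _; case: (F3P (B v e)) => ->.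
Qed.

Lemma card_space : (\sum_(v : V) 1 = 3 ^ n)%N.
Proof. by rewrite sum1_card card_mx card_Fp // mul1n. Qed.

Lemma card_by_norm :
  (3 ^ n = N[v | Q v == 0] + N[v | Q v == 1] + N[v | Q v == -1])%N.
Proof.
rewrite -card_space -!big_split; apply: eq_bigr => v _ /=.
by case: (F3P (Q v)) => ->.
Qed.

(* With as many vectors of norm 1 as of norm -1, the norms of the vectors
   orthogonal to c are determined. *)
Lemma count_perp Z c : Q c = 1 ->
    (N[v | Q v == 1] = Z)%N -> (N[v | Q v == -1] = Z)%N ->
  (9 * N[v | [&& B v c == 0 & Q v == 0]] = 3 ^ n)%N /\
  (N[v | [&& B v c == 0 & Q v == 1]]
     + 2 * N[v | [&& B v c == 0 & Q v == 0]] = Z)%N.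
Proof.
move=> Qc Z1 Z2.
have Qc0 : Q c != 0 by rewrite Qc.
have h a := count_nonisotropic (P := predT) a Qc0 (fun=> erefl).
have := h 0; have := h 1; have := h (-1); rewrite /= Z1 Z2 Qc.
have -> : -1 - 1 = 1 :> 'F_3 by apply/val_inj.
rewrite subrr sub0r card_by_norm Z1 Z2; sums_lia.
Qed.

Lemma count_perp_total c : c != 0 -> (3 * N[v | B v c == 0] = 3 ^ n)%N.
Proof.
case/exists_polar1 => w Bw; rewrite -card_space.
rewrite (@shift_count _ predT (B^~ c) w 0) // => v _.
by rewrite polarDl Bw.
Qed.

(* The isotropic vector t = c' - c or c' + c is orthogonal to c, and
   translation by t equidistributes Q on the vectors of c^perp outside t^perp. *)
Lemma count_perp2 c c' a :
    Q c = 1 -> Q c' = 1 -> B c c' != 0 -> c' != c -> c' != - c ->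
  (27 * N[v | [&& B v c == 0, B v c' == 0 & Q v == a]] + 2 * 3 ^ n
     = 27 * N[v | [&& B v c == 0 & Q v == a]])%N.
Proof.
move=> Qc Qc' Bcc' ne1 ne2.
have [t [t0 Bct Qt eqp]] : exists t, [/\ t != 0, B c t = 0, Q t = 0 &
   forall v, (B v c == 0) && (B v c' == 0) = (B v c == 0) && (B v t == 0)].
  (* As [b] is [1] or [-1], [t = c' + b *: c] has [B c t = b - b = 0] and [Q t = 1 + 1 + 1 = 0]; it
     is nonzero because [c'] is neither [c] nor [- c]. *)
  pose b := B c c'; exists (c' + b *: c).
  rewrite polarDr polarZr polarxx quadD quadZ polarZr [B c' c]polarC Qc Qc' -/b.
  rewrite expr2 F3_sqr // mulr1 mulrN1 subrr F3_two addNr.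
  split=> // [|v]; last first.
    by case: eqP => //= Bvc; rewrite polarDr polarZr Bvc mulr0 addr0.
  rewrite addr_eq0 /b; case: (F3P (B c c')) Bcc' => -> // _; first by rewrite scale1r.
  by rewrite scaleN1r opprK.
pose P v := (B v c == 0) && (B v t != 0).
have Qt1 : (N[v | P v] = 3 * N[v | P v && (Q v == a)])%N.
  have sg b : b != 0 -> (N[v | [&& B v c == 0 & B v t == b]] =
      3 * N[v | [&& B v c == 0, B v t == b & Q v == a]])%N.
    move=> b0; pose R v := (B v c == 0) && (B v t == b).
    rewrite (@shift_count _ R Q (b *: t) a).
    - by congr (_ * _)%N; apply: eq_bigr => v _; rewrite andbA.
    - move=> v; rewrite /R !polarDl !polarZl polarxx Qt [B t c]polarC Bct.
      by rewrite oppr0 !mulr0 !addr0.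
    move=> v /andP[_ /eqP Bvt].
    by rewrite quadD quadZ Qt mulr0 addr0 polarZr Bvt F3_sqr.
  have split_P (R : pred V) : (N[v | P v && R v] =
     N[v | [&& B v c == 0, B v t == 1 & R v]] +
     N[v | [&& B v c == 0, B v t == -1 & R v]])%N.
    rewrite -big_split; apply: eq_bigr => v _; rewrite /P.
    by case: (B v c == 0) => //=; case: (F3P (B v t)) => -> /=; case: (R v).
  rewrite split_P mulnDr -!sg //.
  have := split_P predT.
  rewrite (eq_bigr (fun v => P v : nat)) => [->|v _]; last by rewrite andbT.
  by congr addn; apply: eq_bigr => v _; rewrite andbT.
have c0 : c != 0 by apply: contra_eq_neq Qc => ->; rewrite quad0.
have [w Bwt] := exists_polar1 t0.
have hT := count_perp_total c0.
have hS : (N[v | B v c == 0] = 3 * N[v | [&& B v c == 0 & B v t == 0]])%N.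
  (* Since [B c c = -1] and [B c t = 0], the correction moves [w] into the orthogonal of [c] and
     keeps [B w' t = 1]. *)
  pose w' := w + B w c *: c.
  rewrite (@shift_count _ _ (B^~ t) w' 0) //= => v; rewrite !polarDl !polarZl.
    by rewrite polarxx Qc mulrN1 subrr addr0.
  by rewrite Bct mulr0 addr0 Bwt.
have hP : (N[v | B v c == 0] = N[v | [&& B v c == 0 & B v t == 0]] + N[v | P v])%N.
  by rewrite -big_split; apply: eq_bigr => v _; rewrite /P; case: eqP => //=; case: eqP.
have hPa : (N[v | [&& B v c == 0 & Q v == a]]
    = N[v | [&& B v c == 0, B v c' == 0 & Q v == a]] + N[v | P v && (Q v == a)])%N.
  rewrite -big_split; apply: eq_bigr => v _; rewrite andbA eqp /P.
  by case: (B v c == 0) => //=; case: (B v t == 0) => //=; case: (Q v == a).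
(* A third of all vectors lie in [c^perp], and two thirds of those satisfy [P]; each norm takes a
   third of these, that is [2 * 3 ^ n / 27] vectors. *)
lia.
Qed.

(** * Norm counts from a maximal totally singular subspace *)

Definition orthogonal U v := [forall u, (u \in U) ==> (B v u == 0)].

Lemma orthogonalP U v : reflect {in U, forall u, B v u = 0} (orthogonal U v).
Proof.
apply: (iffP forallP) => [h u uU | h u]; last by apply/implyP => /h ->.
exact/eqP/(implyP (h u)).
Qed.

Lemma card_subspace U : N[v | v \in U] = (3 ^ \dim U)%N.
Proof.
have := card_vspace U; rewrite card_Fp // => <-.
by rewrite -sum1_card [RHS]big_mkcond.
Qed.

(** On [U], [B v] is a nonzero linear form, so it takes all values equally often. *)
Lemma count_functional U v a : ~~ orthogonal U v ->
  N[u | u \in U] = (3 * N[u | (u \in U) && (B v u == a)])%N.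
Proof.
case/forallPn => u; rewrite negb_imply => /andP[uU Bvu].
have wU : B v u *: u \in U by apply: memvZ.
rewrite (@shift_count _ (fun u => u \in U) (B v) (B v u *: u) a) // => x.
  apply/idP/idP => [h|xU]; last by rewrite rpredD.
  by rewrite -(addrK (B v u *: u) x) rpredB.
by rewrite polarDr polarZr F3_sqr.
Qed.

(** Double counting of the pairs [(v, u)] with [u] in [U] and [B v u = 0]: a [v] outside [U^perp] is
    paired with a third of [U], a nonzero [u] with a third of the space. *)
Lemma count_orthogonal U : (N[v | orthogonal U v] * 3 ^ \dim U = 3 ^ n)%N.
Proof.
have byv : (3 * (\sum_v N[u | (u \in U) && (B v u == 0)]) =
    3 ^ n * 3 ^ \dim U + 2 * (N[v | orthogonal U v] * 3 ^ \dim U))%N.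
  rewrite -[X in (X * _ + _)%N]card_space [(2 * _)%N]mulnA ![(2 * _)%N]big_distrr.
  rewrite [(3 * _)%N]big_distrr /= !big_distrl -big_split; apply: eq_bigr => v _ /=.
  rewrite -card_subspace; have [/orthogonalP h|h] := boolP (orthogonal U v).
    rewrite muln1 mul1n -mulSn; congr (_ * _)%N; apply: eq_bigr => u _.
    by case uU: (u \in U) => //=; rewrite h ?eqxx.
  by rewrite -(count_functional 0 h) muln0 mul0n addn0 mul1n.
have byu : (3 * (\sum_v N[u | (u \in U) && (B v u == 0)]) =
    3 ^ n * 3 ^ \dim U + 2 * 3 ^ n)%N.
  rewrite exchange_big /= -card_subspace.
  have -> : (2 * 3 ^ n = \sum_(u : V) (u == 0)%R * (2 * 3 ^ n))%N.
    by rewrite -big_distrl /= (bigD1 0) //= eqxx big1 ?addn0 ?mul1n // => u /negPf->.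
  rewrite !big_distrr -big_split; apply: eq_bigr => u _ /=.
  have [->|u0] := eqVneq u 0.
    rewrite mem0v mul1n muln1 -mulSn -card_space; congr (_ * _)%N.
    by apply: eq_bigr => v _; rewrite polar0r eqxx.
  case: (u \in U) => /=; last by rewrite big1 // !muln0.
  by rewrite count_perp_total // mul0n addn0 muln1.
lia.
Qed.

(* Q is equidistributed on every coset of U outside the orthogonal of U. *)
Lemma count_quad_cosets U a : totally_singular Q U ->
  (3 * N[v | Q v == a] + N[v | orthogonal U v] =
     3 * N[v | orthogonal U v && (Q v == a)] + 3 ^ n)%N.
Proof.
move=> /forallP tsU.
have U0 : (0 < N[u | u \in U])%N by rewrite card_subspace expn_gt0.
(* Multiplying by the size of [U] allows averaging over each coset [v + U], where
   [Q (v + u) = Q v + B v u]. *)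
apply/eqP; rewrite -(eqn_pmul2l U0) mulnDr [eqbRHS]mulnDr; apply/eqP.
have byu : (\sum_v N[u | (u \in U) && (Q (v + u) == a)] =
    N[u | u \in U] * N[v | Q v == a])%N.
  rewrite exchange_big big_distrl; apply: eq_bigr => u _ /=.
  case: (u \in U) => /=; last by rewrite mul0n big1.
  by rewrite mul1n [RHS](reindex_inj (addIr u)).
rewrite mulnCA -byu mulnCA -card_space !big_distrr -!big_split.
apply: eq_bigr => v _ /=.
have -> : N[u | (u \in U) && (Q (v + u) == a)]
        = N[u | (u \in U) && (B v u == a - Q v)].
  apply: eq_bigr => u _; case uU: (u \in U) => //=.
  have /eqP Qu := implyP (tsU u) uU.
  by rewrite quadD Qu addr0 -(inj_eq (addIr (Q v)) (B v u)) subrK addrC.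
have [/orthogonalP h|h] := boolP (orthogonal U v).
  rewrite muln1 /=; congr (_ + _)%N; congr (3 * _)%N.
  rewrite big_distrl; apply: eq_bigr => u _ /=; case uU: (u \in U) => //=.
  by rewrite h // mul1n eq_sym subr_eq0 eq_sym.
by rewrite -(count_functional (a - Q v) h) muln0 addn0 /= !muln0 add0n muln1.
Qed.

Lemma witt_indexP :
  exists2 U, totally_singular Q U & \dim U = witt_index Q.
Proof.
have ts0 : totally_singular Q 0%VS.
  by apply/forallP => x; rewrite memv0; apply/implyP => /eqP ->; rewrite quad0.
have h : (0 < #|totally_singular Q|)%N by apply/card_gt0P; exists 0%VS.
by have [U tsU eqU] := eq_bigmax_cond (fun U => \dim U) h; exists U.
Qed.

Lemma totally_singular_orthogonal U u :
  totally_singular Q U -> u \in U -> orthogonal U u.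
Proof.
move=> /forallP tsU uU; apply/orthogonalP => v vU.
have ts x : x \in U -> Q x = 0 by move=> xU; apply/eqP/(implyP (tsU x)).
by rewrite /polar !ts ?rpredD // !subr0.
Qed.

(** Adjoining [v] keeps [U] totally singular, so maximality of the dimension forces [v] into [U]. *)
Lemma maximal_totally_singular U v : totally_singular Q U ->
  \dim U = witt_index Q -> orthogonal U v -> Q v = 0 -> v \in U.
Proof.
move=> /forallP tsU dU /orthogonalP oUv Qv.
have ts x : x \in U -> Q x = 0 by move=> xU; apply/eqP/(implyP (tsU x)).
have tsUv : totally_singular Q (U + <[v]>)%VS.
  apply/forallP => x; apply/implyP => /memv_addP[u uU [w /vlineP[k ->] ->]].
  by rewrite quadD quadZ Qv ts // polarC polarZl oUv // !mulr0 !addr0.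
have le : (\dim (U + <[v]>) <= \dim U)%N.
  by rewrite dU; apply: (leq_bigmax_cond (U + <[v]>)%VS tsUv).
have /eqP -> : U == (U + <[v]>)%VS by rewrite -(geq_leqif (dimv_leqif_eq (addvSl _ _))).
exact/(subvP (addvSr _ _))/memv_line.
Qed.

(** Here a maximal totally singular [U] has dimension [m] and, by counting, equals [U^perp]. So the
    norm [a] does not occur on [U^perp], and it is taken by a third of the other [3 ^ n - 3 ^ m]
    vectors. *)
Lemma hyperbolic_count m a : n = (2 * m)%N -> hyperbolic Q -> a != 0 ->
  (3 * N[v | Q v == a] + 3 ^ m = 3 ^ n)%N.
Proof.
move=> nm hyp a0; have [U tsU dU] := witt_indexP.
have {}dU : \dim U = m.
  by rewrite dU; move: hyp; rewrite /hyperbolic; move: (witt_index Q) nm => w; lia.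
have cO : N[v | orthogonal U v] = (3 ^ m)%N.
  apply/eqP; rewrite -(@eqn_pmul2r (3 ^ m)) ?expn_gt0 //.
  by rewrite -{1}dU count_orthogonal nm -expnD addnn mul2n.
have OU v : orthogonal U v = (v \in U).
  have le x : ((x \in U) <= orthogonal U x)%N.
    by case xU: (x \in U) => //; rewrite (totally_singular_orthogonal tsU).
  have : (\sum_v (orthogonal U v - (v \in U)) == 0)%N.
    by rewrite sumnB // cO card_subspace dU subnn.
  rewrite sum_nat_eq0 => /forallP /(_ v).
  by move: (le v); case: (orthogonal U v); case: (v \in U).
have := count_quad_cosets a tsU; rewrite cO => ->.
rewrite big1 ?muln0 ?add0n // => v _; rewrite OU.
case vU: (v \in U) => //=.
by have /forallP/(_ v)/implyP/(_ vU)/eqP -> := tsU; rewrite eq_sym (negPf a0).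
Qed.

(* On U^perp, where U is a maximal totally singular subspace, Q is the pullback
   of an anisotropic form of rank 2, which takes every nonzero value equally often. *)
Lemma elliptic_count m a : n = (2 * m)%N -> elliptic Q -> a != 0 ->
  (3 * N[v | Q v == a] = 3 ^ n + 3 ^ m)%N.
Proof.
move=> nm ell a0; have [U tsU dU] := witt_indexP.
have mw : m = (witt_index Q).+1.
  by move: ell; rewrite /elliptic; move: (witt_index Q) nm => w; lia.
move: (dU); rewrite mw; set w := witt_index Q => dU'.
have cO : N[v | orthogonal U v] = (9 * 3 ^ w)%N.
  apply/eqP; rewrite -(@eqn_pmul2r (3 ^ w)) ?expn_gt0 //.
  rewrite -{1}dU' count_orthogonal nm mw -mulnA -expnD -(expnD 3 2).
  by apply/eqP; congr expn; lia.
have cU : N[v | v \in U] = (3 ^ w)%N by rewrite card_subspace dU'.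
have OQ v : orthogonal U v && (Q v == 0) = (v \in U).
  apply/andP/idP => [[oUv /eqP]|vU]; first exact: maximal_totally_singular.
  split; first exact: totally_singular_orthogonal.
  by have /forallP/(_ v)/implyP/(_ vU) := tsU.
(* Otherwise [U^perp] would equal [U], although it is nine times as large. *)
have [e oUe Qe] : exists2 e, orthogonal U e & Q e != 0.
  have [/exists_inP[e]|/exists_inPn h] :=
    boolP [exists (e | orthogonal U e), Q e != 0].
    by exists e.
  have w0 : (0 < 3 ^ w)%N by rewrite expn_gt0.
  suff : N[v | orthogonal U v] = N[v | v \in U] by rewrite cO cU; lia.
  apply: eq_bigr => v _; rewrite -OQ; case oUv: (orthogonal U v) => //=.
  by have /negPn -> := h v oUv.
have /orthogonalP oUe' := oUe.
have shiftO v : orthogonal U (v + e) = orthogonal U v.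
  by apply: eq_forallb => u; case uU: (u \in U); rewrite //= polarDl oUe' ?addr0.
have h b := count_nonisotropic (P := orthogonal U) b Qe shiftO.
(* Such a [v] would make [v + e] singular in [U^perp], hence in [U], but [B e (v + e) = - Q e] is
   nonzero. *)
have k2 : N[v | [&& orthogonal U v, B v e == 0 & Q v == - Q e]] = 0%N.
  rewrite big1 // => v _; case: and3P => // -[oUv /eqP Bve /eqP Qv].
  have : v + e \in U by rewrite -OQ shiftO oUv quadD Qv Bve addr0 addNr eqxx.
  move=> /(oUe'); rewrite polarDr polarxx polarC Bve add0r => /eqP.
  by rewrite oppr_eq0 (negPf Qe).
have tot : N[v | orthogonal U v] = (N[v | orthogonal U v && (Q v == 0)]
   + N[v | orthogonal U v && (Q v == Q e)] + N[v | orthogonal U v && (Q v == - Q e)])%N.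
  rewrite -!big_split; apply: eq_bigr => v _ /=; case: (orthogonal U v) => //=.
  by case: (F3P (Q e)) Qe => -> // _; case: (F3P (Q v)) => ->.
have z0 : N[v | orthogonal U v && (Q v == 0)] = (3 ^ w)%N.
  by rewrite -cU; apply: eq_bigr => v _; rewrite OQ.
have e2 : - Q e - Q e = Q e by case: (F3P (Q e)) => ->; apply/val_inj.
(* Let [x] count the vectors of norm [Q e] in [U^perp] orthogonal to [e]. The norms [Q e] and
   [- Q e] occur [x + 2 * 3 ^ w] and [2 x] times in [U^perp], and the total [9 * 3 ^ w] gives
   [x = 2 * 3 ^ w]. *)
have za : N[v | orthogonal U v && (Q v == a)] = (4 * 3 ^ w)%N.
  have aQ : a = Q e \/ a = - Q e.
    by case: (F3P a) (F3P (Q e)) a0 Qe => -> [] -> //; rewrite ?opprK; auto.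
  case: aQ => ->; move: tot (h 0) (h (Q e)) (h (- Q e));
    rewrite sub0r e2 subrr k2 z0 cO; sums_lia.
have := count_quad_cosets a tsU; rewrite cO za expnS; sums_lia.
Qed.

(** * Moments of the degree and bounds on cocliques *)

(** The condition [c' != - c] makes distinct vectors of [C] span distinct lines. *)
Definition pairwise_nonorthogonal (C : {set V}) : Prop :=
  {in C, forall c, Q c = 1} /\
  {in C &, forall c c', c != c' -> B c c' != 0 /\ c' != - c}.

Section Moments.
Variables (C : {set V}) (a : 'F_3) (k l : nat).
Hypotheses
  (Ck : {in C, forall c, N[v | (B v c == 0) && (Q v == a)] = k})
  (Cl : {in C &, forall c c', c != c' ->
     N[v | [&& B v c == 0, B v c' == 0 & Q v == a]] = l}).

Definition degree v : nat := (\sum_(c in C) (B v c == 0)%R)%N.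

Lemma first_moment : (\sum_v (Q v == a)%R * degree v = #|C| * k)%N.
Proof.
under eq_bigr do rewrite /degree big_distrr.
rewrite exchange_big -sum_nat_const; apply: eq_bigr => c cC.
by rewrite -(Ck cC); apply: eq_bigr => v _ /=; rewrite mulnC mulnb.
Qed.

(** The squared degree counts ordered pairs from [C] orthogonal to [v]; a diagonal pair contributes
    [k] and any other [l]. *)
Lemma second_moment :
  (\sum_v (Q v == a)%R * degree v ^ 2 = #|C| * (k + #|C|.-1 * l))%N.
Proof.
transitivity (\sum_(c in C) \sum_(c' in C)
    N[v | [&& B v c == 0, B v c' == 0 & Q v == a]])%N.
  under [RHS]eq_bigr do rewrite exchange_big.
  rewrite [RHS]exchange_big; apply: eq_bigr => v _.
  rewrite expnS expn1 /degree big_distrl big_distrr; apply: eq_bigr => c _.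
  rewrite big_distrr big_distrr; apply: eq_bigr => c' _ /=.
  by case: (Q v == a); case: (B v c == 0); case: (B v c' == 0).
rewrite -sum_nat_const; apply: eq_bigr => c cC.
rewrite (bigD1 c) //=; congr (_ + _)%N.
  by rewrite -(Ck cC); apply: eq_bigr => v _; case: (B v c == 0).
rewrite (eq_bigr (fun=> l)) => [|c' /andP[c'C ne]]; last by rewrite (Cl cC) // eq_sym.
rewrite sum_nat_const; congr (_ * _)%N; rewrite [in RHS](cardD1 c) cC.
by apply: eq_card => x; rewrite !inE andbC.
Qed.

End Moments.

Lemma hyperbolic_coclique m (C : {set V}) : n = (2 * m)%N -> (2 <= m)%N ->
  hyperbolic Q -> pairwise_nonorthogonal C -> (2 * #|C| < 3 ^ m)%N.
Proof.
move=> nm m2 hyp [C1 C2].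
(* This parametrization keeps all later counts polynomial in [s], without division or truncated
   subtraction. *)
have [s es] : exists s, (3 ^ m = 9 * s.+1)%N.
  exists (3 ^ (m - 2)).-1; rewrite prednK ?expn_gt0 //.
  by rewrite -(expnD 3 2) subnKC.
have en : (3 ^ n = (9 * s.+1) ^ 2)%N by rewrite nm mulnC expnM es.
have cZ b : b != 0 -> N[v | Q v == b] = (3 * s.+1 * (9 * s + 8))%N.
  by move=> b0; have := hyperbolic_count nm hyp b0; rewrite en es; sums_lia.
have Ck : {in C, forall c, N[v | (B v c == 0) && (Q v == 1)] = 3 * s.+1 * (3 * s + 2)}%N.
  move=> c /C1 Qc; have := count_perp Qc (cZ 1 isT) (cZ (-1) isT).
  rewrite en; sums_lia.
have Cl : {in C &, forall c c', c != c' ->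
    N[v | [&& B v c == 0, B v c' == 0 & Q v == 1]] = 3 * s.+1 * s}%N.
  move=> c c' cC c'C ne; have [Bcc' ne'] := C2 c c' cC c'C ne.
  have := count_perp2 1 (C1 c cC) (C1 c' c'C) Bcc' _ ne'; rewrite eq_sym => /(_ ne).
  by rewrite (Ck c cC) en; sums_lia.
have := weighted_Cauchy (fun v => Q v == 1) (degree C).
rewrite (first_moment Ck) (second_moment Ck Cl) cZ // es.
case: #|C| => [|N] /=; first by [].
set t := s.+1 => h.
have : (9 * t ^ 2 * N.+1 * (N.+1 * (3 * s + 2) ^ 2)
    <= 9 * t ^ 2 * N.+1 * ((9 * s + 8) * (3 * s + 2 + N * s)))%N.
  by apply: leq_trans (leq_trans h _); apply/eq_leq; ring.
rewrite leq_pmul2l // => {}h.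
(* After cancellation, [2 N <= 9 s + 6]; with [N + 1] vectors in [C] this is
   [2 * #|C| <= 9 s + 8 = 3 ^ m - 1]. *)
have : (s.+1 * (4 * N) <= s.+1 * (18 * s + 12))%N.
  rewrite -(leq_add2l (N.+1 * (3 * s + 2) ^ 2)).
  apply: leq_trans (leq_add h (leqnn _)) _; apply/eq_leq; ring.
by rewrite leq_pmul2l // /t; lia.
Qed.

Section EllipticCoclique.
Variables (m s : nat) (C : {set V}).
Hypotheses (nm : n = (2 * m)%N) (es : (3 ^ m = 9 * s.+1)%N) (ell : elliptic Q).
Hypothesis nonorthC : pairwise_nonorthogonal C.

Let en : (3 ^ n = (9 * s.+1) ^ 2)%N.
Proof. by rewrite nm mulnC expnM es. Qed.

Let cZ b : b != 0 -> N[v | Q v == b] = (3 * s.+1 * (9 * s + 10))%N.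
Proof. by move=> b0; have := elliptic_count nm ell b0; rewrite en es; sums_lia. Qed.

Lemma elliptic_count_singular : N[v | Q v == 0] = (3 * s.+1 * (9 * s + 7))%N.
Proof.
have := card_by_norm; rewrite en (cZ (b := 1)) // (cZ (b := -1)) //; sums_lia.
Qed.

Let Ck : {in C, forall c, N[v | (B v c == 0) && (Q v == 0)] = 9 * s.+1 ^ 2}%N.
Proof.
move=> c /(proj1 nonorthC) Qc.
have := count_perp Qc (cZ (b := 1) isT) (cZ (b := -1) isT).
by rewrite en; sums_lia.
Qed.

Let Cl : {in C &, forall c c', c != c' ->
  N[v | [&& B v c == 0, B v c' == 0 & Q v == 0]] = 3 * s.+1 ^ 2}%N.
Proof.
case: nonorthC => C1 C2 c c' cC c'C ne; have [Bcc' ne'] := C2 c c' cC c'C ne.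
have := count_perp2 0 (C1 c cC) (C1 c' c'C) Bcc' _ ne'; rewrite eq_sym => /(_ ne).
by rewrite (Ck cC) en; sums_lia.
Qed.

Lemma elliptic_coclique : (#|C| + 2 <= 3 ^ m)%N.
Proof.
have := weighted_Cauchy (fun v => Q v == 0) (degree C).
rewrite (first_moment Ck) (second_moment Ck Cl) elliptic_count_singular es.
case: #|C| => [|N] /= h; first by lia.
have {h} : (9 * s.+1 ^ 3 * N.+1 * (9 * s.+1 * N.+1)
    <= 9 * s.+1 ^ 3 * N.+1 * ((9 * s + 7) * (N + 3)))%N.
  by apply: leq_trans (leq_trans h _); apply/eq_leq; ring.
(* The reduced inequality amounts to [N <= 9 s + 6], where [#|C| = N + 1] and [3 ^ m = 9 s + 9]. *)
by rewrite leq_pmul2l //; lia.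
Qed.

(* The degree into C of a singular vector has mean close to 15/2, so that the
   integrality of (d - 7)(d - 8) improves on the Cauchy bound. *)
Lemma elliptic6_coclique_neq : m = 3 -> #|C| <> 21.
Proof.
move=> m3 C21; have s2 : s = 2 by move: es; rewrite m3; lia.
have := first_moment Ck; have := second_moment Ck Cl; have := elliptic_count_singular.
rewrite C21 s2 => Z0 S2 S1.
(* The expression [d ^ 2 - 15 d + 56 = (d - 7)(d - 8)] is nonnegative for every degree and is
   [14 * 13 = 182] at [v = 0], which has degree 21. By the moments its sum is only
   [13041 - 15 * 1701 + 56 * 225 = 126]. *)
have : (15 * (\sum_v (Q v == 0)%R * degree C v) + \sum_(v : V) (v == 0)%R * 182
   <= \sum_v (Q v == 0)%R * degree C v ^ 2 + 56 * N[v | Q v == 0])%N.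
  rewrite !big_distrr -!big_split; apply: leq_sum => v _ /=.
  have [->|v0] := eqVneq v 0.
    rewrite quad0 eqxx (_ : degree C 0 = 21) // /degree.
    by rewrite -C21 -sum1_card; apply: eq_bigr => c _; rewrite polar0l eqxx.
  case: (Q v == 0); rewrite //= !mul1n addn0 muln1; move: (degree C v) => d.
  by rewrite -mulnn; have [le|lt] := leqP d 7; nia.
have -> : (\sum_(v : V) (v == 0)%R * 182 = 182)%N.
  by rewrite (bigD1 0) //= eqxx big1 ?addn0 ?mul1n // => u /negPf->.
by rewrite S1 S2 Z0.
Qed.

End EllipticCoclique.

Lemma pairwise_nonorthogonalS (C D : {set V}) :
  D \subset C -> pairwise_nonorthogonal C -> pairwise_nonorthogonal D.
Proof.
move=> /subsetP DC [C1 C2]; split=> [c /DC|c c' /DC cC /DC c'C]; first exact: C1.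
exact: C2.
Qed.

(** A larger set would contain one of exactly 21 vectors, which is excluded. *)
Lemma elliptic6_coclique (C : {set V}) : n = 6 -> elliptic Q ->
  pairwise_nonorthogonal C -> (#|C| <= 20)%N.
Proof.
move=> n6 ell nC; rewrite leqNgt; apply/negP => /card_geqP[r [ur sr rC]].
have DC : [set x in r] \subset C by apply/subsetP => x; rewrite inE => /rC.
apply: (@elliptic6_coclique_neq 3 2 [set x in r]) => //.
  exact: pairwise_nonorthogonalS nC.
by rewrite cardsE; move/card_uniqP: ur => ->.
Qed.

(** * Passage from the vertices of the graph to vectors of norm 1 *)

Definition vertex_vector (W : NO_graph Q) : V := xchoose (existsP (valP W)).

Lemma vertex_vectorP (W : NO_graph Q) :
  Q (vertex_vector W) = 1 /\ val W = <[vertex_vector W]>%VS.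
Proof. by have /andP[/eqP ? /eqP ?] := xchooseP (existsP (valP W)). Qed.

Lemma eq_line_norm1 x y : Q x = 1 -> Q y = 1 ->
  (<[x]> = <[y]>)%VS -> x = y \/ x = - y.
Proof.
move=> Qx Qy exy; have : x \in <[y]>%VS by rewrite -exy memv_line.
case/vlineP => k ek; move: Qx; rewrite ek.
case: (F3P k) => ->; first by rewrite scale0r quad0.
  by rewrite scale1r; left.
by rewrite scaleN1r; right.
Qed.

Lemma vertex_vector_neq (W W' : NO_graph Q) : W != W' ->
  vertex_vector W != vertex_vector W' /\ vertex_vector W' != - vertex_vector W.
Proof.
have [_ eW] := vertex_vectorP W; have [_ eW'] := vertex_vectorP W'.
move=> neW; split; apply: contra neW => /eqP e; apply/eqP/val_inj => /=.
  by rewrite eW eW' e.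
rewrite eW eW' e; apply/eqP; rewrite eqEsubv -!memvE; apply/andP; split.
  by rewrite -memvN memv_line.
by rewrite memvN memv_line.
Qed.

(** By bilinearity, orthogonality of two lines does not depend on the spanning vectors. *)
Lemma adj_vertex_vector (W W' : NO_graph Q) :
  adj W W' = (W != W') && (B (vertex_vector W) (vertex_vector W') == 0).
Proof.
have [QW eW] := vertex_vectorP W; have [QW' eW'] := vertex_vectorP W'.
congr (_ && _); apply/existsP/idP => [[x /existsP[y]]|h].
  case/and3P=> /eqP eWx /eqP eW'y /eqP Bxy.
  have /vlineP[k ->] : vertex_vector W \in <[x]>%VS by rewrite -eWx eW memv_line.
  have /vlineP[k' ->] : vertex_vector W' \in <[y]>%VS by rewrite -eW'y eW' memv_line.
  by rewrite polarZl polarZr Bxy !mulr0.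
exists (vertex_vector W); apply/existsP; exists (vertex_vector W').
by rewrite h -eW -eW' !eqxx.
Qed.

(** A vector of norm 1 is the chosen vector of its line or the negative of it. This bounds the
    number of vertices from below. *)
Lemma count_norm1_vertices : (N[v | Q v == 1] <= 2 * #|NO_graph Q|)%N.
Proof.
have -> : N[v | Q v == 1] = #|[set v | Q v == 1]|.
  by rewrite -sum1_card [RHS]big_mkcond; apply: eq_bigr => v _; rewrite inE.
have sub : [set v | Q v == 1] \subset [set vertex_vector W | W : NO_graph Q]
   :|: [set - vertex_vector W | W : NO_graph Q].
  apply/subsetP => v; rewrite !inE => /eqP Qv.
  have Wv : [exists x : V, (Q x == 1) && (<[v]>%VS == <[x]>%VS)].
    by apply/existsP; exists v; rewrite Qv !eqxx.
  pose W : NO_graph Q := exist _ <[v]>%VS Wv.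
  have [QW eW] := vertex_vectorP W.
  have [e|e] := eq_line_norm1 Qv QW eW; apply/orP; [left|right];
    by apply/imsetP; exists W.
apply: leq_trans (subset_leq_card sub) _.
by rewrite mul2n -addnn (leq_trans (leq_card_setU _ _)) // leq_add // leq_imset_card.
Qed.

(** Pairing a relation [u *m M = 0] with row [j] leaves only [- u 0 j], since the rows are pairwise
    orthogonal and [B c c = -1]; so the rows are independent. *)
Lemma clique_bound : (clique_number (NO_graph Q) <= n)%N.
Proof.
apply/bigmax_leqP => A clA.
pose M := \matrix_(i < #|A|) vertex_vector (enum_val i).
suff /eqP <- : row_free M by apply: rank_leq_col.
rewrite -kermx_eq0; apply/rowV0P => u /sub_kermxP uM; apply/rowP => j.
have : B (u *m M) (vertex_vector (enum_val j)) = 0 by rewrite uM polar0l.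
rewrite mulmx_sum_row polar_suml (bigD1 j) //= big1 => [|i ij].
  rewrite rowK polarZl polarxx (vertex_vectorP _).1 addr0 mulrN1 => /eqP.
  by rewrite oppr_eq0 mxE => /eqP.
rewrite rowK polarZl; have /forall_inP/(_ _ (enum_valP i)) := clA.
move=> /forall_inP/(_ _ (enum_valP j)); rewrite (inj_eq enum_val_inj) ij implyTb.
by rewrite adj_vertex_vector => /andP[_ /eqP ->]; rewrite mulr0.
Qed.

Lemma coclique_bound b :
    (forall C : {set V}, pairwise_nonorthogonal C -> (#|C| <= b)%N) ->
  (coclique_number (NO_graph Q) <= b)%N.
Proof.
move=> hb; apply/bigmax_leqP => A cocA.
have inj : injective vertex_vector.
  move=> W W' e; apply/eqP; apply: contraT => /vertex_vector_neq[].
  by rewrite e eqxx.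
rewrite -(card_imset _ inj); apply: hb; split=> [c /imsetP[W _ ->]|].
  by have [] := vertex_vectorP W.
move=> _ _ /imsetP[W WA ->] /imsetP[W' W'A ->]; rewrite (inj_eq inj) => ne.
have [_ ?] := vertex_vector_neq ne; split=> //.
have /forall_inP/(_ _ WA)/forall_inP/(_ _ W'A) := cocA.
by rewrite adj_vertex_vector ne.
Qed.

End Forms.

(** * Numerical estimates and the comparison with the number of vertices *)

Lemma pow3_gt m : (3 <= m)%N -> (6 * m < 3 ^ m)%N.
Proof.
by move/subnKC <-; elim: (m - 3)%N => // k; rewrite addnS expnS; lia.
Qed.

(** At [m = 3] this fails, [36] exceeding [27]; hence the separate treatment of that elliptic
    case. *)
Lemma pow3_ge m : (4 <= m)%N -> (12 * m <= 3 ^ m)%N.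
Proof.
by move/subnKC <-; elim: (m - 4)%N => // k; rewrite addnS expnS; lia.
Qed.

Theorem theorem3p2 (m : nat) (hm : (3 <= m)%N)
    (eps : int) (heps : eps = 1 \/ eps = -1)
    (Q : 'rV['F_3]_(2 * m) -> 'F_3)
    (Q_quadratic : quadratic_form Q)
    (Q_nondeg : nondegenerate_form Q)
    (Q_type : has_type Q eps) :
  separating (NO_graph Q).
Proof.
have [t em] : exists t, (3 ^ m = 9 * t.+1)%N.
  exists (3 ^ (m - 2)).-1; rewrite prednK ?expn_gt0 //.
  by rewrite -(expnD 3 2) subnKC // ltnW.
have en : (3 ^ (2 * m) = (9 * t.+1) ^ 2)%N by rewrite mulnC expnM em.
have vtx := count_norm1_vertices Q_quadratic.
have clq := clique_bound Q_quadratic.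
rewrite /separating; case: heps Q_type => -> /= Q_type.
  have := hyperbolic_count Q_quadratic Q_nondeg (erefl _) Q_type (oner_neq0 _).
  have coc : (coclique_number (NO_graph Q) <= (9 * t + 8) %/ 2)%N.
    apply: (coclique_bound Q_quadratic) => C nC.
    have := hyperbolic_coclique Q_quadratic Q_nondeg (erefl _) (ltnW hm) Q_type nC.
    by rewrite em leq_divRL //; lia.
  rewrite em en => cnt.
  have {}cnt : (N[v | Q v == 1] = 3 * t.+1 * (9 * t + 8))%N.
    by move: cnt; sums_lia.
  rewrite cnt in vtx; have mt := pow3_gt hm; rewrite em in mt.
  (* The product is at most [m (3 ^ m - 1)], against at least [3 ^ (m - 1) (3 ^ m - 1) / 2]
     vertices; [6 m < 3 ^ m] decides. *)
  apply: leq_ltn_trans (leq_mul clq coc) _.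
  have := leq_trunc_div (9 * t + 8) 2; move: (_ %/ 2)%N => b b2.
  by move: #|_| vtx => g; clear -mt b2; nia.
have := elliptic_count Q_quadratic Q_nondeg (erefl _) Q_type (oner_neq0 _).
rewrite em en => cnt.
have {}cnt : (N[v | Q v == 1] = 3 * t.+1 * (9 * t + 10))%N.
  by move: cnt; sums_lia.
rewrite cnt in vtx.
case: (ltngtP 3 m) hm => // [m4 _|m3 _]; last first.
  (* For [m = 3] the comparison is [6 * 20 = 120 < 126]. *)
  have t2 : t = 2 by move: em; rewrite -m3; lia.
  have coc : (coclique_number (NO_graph Q) <= 20)%N.
    apply: (coclique_bound Q_quadratic) => C.
    by apply: (elliptic6_coclique Q_quadratic Q_nondeg) => //; rewrite -m3.
  rewrite t2 in vtx.
  by apply: leq_ltn_trans (leq_mul clq coc) _; move: #|_| vtx => g; clear -m3; lia.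
have coc : (coclique_number (NO_graph Q) <= 9 * t + 7)%N.
  apply: (coclique_bound Q_quadratic) => C nC.
  have := elliptic_coclique Q_quadratic Q_nondeg (erefl _) em Q_type nC.
  by rewrite em; lia.
apply: leq_ltn_trans (leq_mul clq coc) _.
have mt := pow3_ge m4; rewrite em in mt.
by move: #|_| vtx => g; clear -mt; nia.
Qed.
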